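(* Let $G$ be a finite group with identity $e$, $R[G]$ its real group algebra, and $S=\{x\in R[G]: \sum_g x_g=1,\ x_g\ge0\ \forall g\}$. Let $(p^{[n]}(t))_{n\in\mathbb N}$, $p^{[n]}(t)=\sum_{k=0}^\infty a_k^{[n]}t^k$, be any sequence of real power series with $\sum_{k=0}^\infty|a_k^{[n]}|<\infty$ for every $n$ and $\lim_{n\to\infty}\sup_{k\ge1}|a_k^{[n]}|=0$. Let $x\in S$ with $n_{xc_x}=n_x$. (1) If $c_x\neq e$, then $\lim_{n\to\infty}p^{[n]}(x)$ exists if and only if $\lim_{n\to\infty}a_0^{[n]}$ exists and $\lim_{n\to\infty}\sum_{k=0}^\infty a^{[n]}_{km_x+r}$ exists for every $0\le r<m_x$. (2) If $c_x=e$, then $\lim_{n\to\infty}p^{[n]}(x)$ exists if and only if $\lim_{n\to\infty}\sum_{k=0}^\infty a^{[n]}_{km_x+r}$ exists for every $0\le r<m_x$. When the limit exists, $$\lim_{n\to\infty}p^{[n]}(x)=c_x\sum_{r=0}^{m_x-1}x^r\lim_{n\to\infty}\sum_{k=0}^\infty a^{[n]}_{km_x+r}+(e-c_x)\lim_{n\to\infty}a_0^{[n]}.$$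
   Context: Here $(p^{[n]})$ is an arbitrary sequence (not necessarily iterates). For $y\in S$, $p^{[n]}(y)=a_0^{[n]}e+\sum_{k\ge1}a_k^{[n]}y^k$ (convergent). $\mathrm{Supp}(y)=\{g: y_g\ne0\}$, $\mathbb N=\{1,2,\dots\}$, Euclidean topology on $R[G]$. For $y\in S$: $n_y=\min\{k\in\mathbb N:(y^k)_e\ne0\}$; $G_y$ is the subgroup generated by $\mathrm{Supp}(y^{n_y})$; $c_y=\frac1{|G_y|}\sum_{g\in G_y}g$; $m_y=\min\{k\in\mathbb N: \mathrm{Supp}(y^k)\subset G_y\}$. Note $xc_x\in S$, so $n_{xc_x}$ is defined. *)

(* Defs.v *)
From HB Require Import structures.
From mathcomp Require Import all_boot all_order all_algebra all_fingroup.
From mathcomp Require Import all_classical all_reals all_analysis.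
Set Implicit Arguments. Unset Strict Implicit. Unset Printing Implicit Defensive.
Import Order.TTheory GRing.Theory Num.Theory numFieldNormedType.Exports.
Local Open Scope ring_scope.

Section GroupAlgebra.
Variables (R : realType) (gT : finGroupType).

(* An element x of the real group algebra R[G] is a coefficient function
   x : gT -> R (x_g = coefficient of g). *)
Definition ga_mul (x y : gT -> R) : gT -> R :=
  fun g => \sum_(h : gT) x h * y (h^-1 * g)%g.

Definition ga_e : gT -> R := fun g => (g == 1%g)%:R.

Fixpoint ga_pow (x : gT -> R) (k : nat) : gT -> R :=
  match k with 0%N => ga_e | k'.+1 => ga_mul (ga_pow x k') x end.

Definition inS (x : gT -> R) : Prop :=
  \sum_(g : gT) x g = 1 /\ forall g, 0 <= x g.

Definition ga_supp (y : gT -> R) : {set gT} := [set g | y g != 0].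

Definition n_of (y : gT -> R) : nat :=
  match pselect (exists k, (0 < k)%N && (ga_pow y k 1%g != 0)) with
  | left h => ex_minn h
  | right _ => 0%N
  end.

Definition G_of (y : gT -> R) : {group gT} := <<ga_supp (ga_pow y (n_of y))>>%G.

Definition c_of (y : gT -> R) : gT -> R :=
  fun g => (g \in G_of y)%:R / #|G_of y|%:R.

Definition m_of (y : gT -> R) : nat :=
  match pselect (exists k, (0 < k)%N && (ga_supp (ga_pow y k) \subset G_of y)) with
  | left h => ex_minn h
  | right _ => 0%N
  end.

Definition peval (a : nat -> R) (y : gT -> R) : gT -> R :=
  fun g => a 0%N * ga_e g + limn (series (fun k => a k.+1 * ga_pow y k.+1 g)).

End GroupAlgebra.

(* Main.v *)
Require Import Defs.
From HB Require Import structures.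
From mathcomp Require Import all_boot all_order all_algebra all_fingroup.
From mathcomp Require Import all_classical all_reals all_analysis.
From mathcomp Require Import lra.
Import Order.TTheory GRing.Theory Num.Theory numFieldNormedType.Exports.
Local Open Scope ring_scope.

(* Let H = G_x and X = Supp x. As e lies in X^n for n = n_x, the group H is a
   power of X^n, hence commutes with X, and X lies in a single coset sH with s
   normalising H. Thus x^k c_x = c_x x^k is the uniform measure on s^k H, which
   is periodic in k of exact period m_x. Some power of x has support exactly H
   and dominates a multiple of c_x, so the norm of x^k - x^k c_x decays
   geometrically; as sup_k |a_k| tends to 0, the terms of degree
   k >= 1 contribute o(1) to p(x) (e - c_x). What remains is
   a_0 (e - c_x) + sum_r x^r c_x A_r, with A_r the sum of a_k over k = r mod m_x,
   and summing its coefficients over s^r H recovers A_r. *)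

(** * Convolution, supports and uniform measures on cosets *)

Section GroupAlgebraTheory.
Context {R : realType} {gT : finGroupType}.
Implicit Types (x y z : gT -> R) (g h t : gT) (k : nat) (H : {group gT}).

Lemma ga_mulA x y z : ga_mul x (ga_mul y z) = ga_mul (ga_mul x y) z.
Proof.
apply/funext => g; rewrite /ga_mul.
under eq_bigr => h _ do rewrite mulr_sumr (reindex_inj (mulgI h^-1%g)).
rewrite exchange_big; apply: eq_bigr => u _; rewrite mulr_suml.
by apply: eq_bigr => h _; rewrite mulrA invMg invgK -mulgA mulKVg.
Qed.

Lemma ga_mul1l x : ga_mul (@ga_e R gT) x = x.
Proof.
apply/funext => g; rewrite /ga_mul (bigD1 1%g)//= /ga_e eqxx mul1r invg1 mul1g.
by rewrite big1 ?addr0// => h /negPf ->; rewrite mul0r.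
Qed.

Lemma ga_mul1r x : ga_mul x (@ga_e R gT) = x.
Proof.
apply/funext => g; rewrite /ga_mul (bigD1 g)//= /ga_e mulVg eqxx mulr1.
rewrite big1 ?addr0// => h hg.
by rewrite -eq_mulVg1 (negPf hg) mulr0.
Qed.

Lemma ga_powD x i j : ga_pow x (i + j) = ga_mul (ga_pow x i) (ga_pow x j).
Proof.
elim: j => [|j IH]; first by rewrite addn0 ga_mul1r.
by rewrite addnS /= IH ga_mulA.
Qed.

Lemma sum_ga_mul x y :
  \sum_g ga_mul x y g = (\sum_g x g) * (\sum_g y g).
Proof.
rewrite /ga_mul exchange_big mulr_suml; apply: eq_bigr => h _.
by rewrite -mulr_sumr (reindex_inj (mulgI h)); under eq_bigr do rewrite mulKg.
Qed.

Definition ga_norm x : R := \sum_g `|x g|.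

Lemma ga_norm_ge0 x : 0 <= ga_norm x.
Proof. exact: sumr_ge0. Qed.

Lemma ler_ga_norm x g : `|x g| <= ga_norm x.
Proof. by rewrite /ga_norm (bigD1 g)//= lerDl sumr_ge0. Qed.

Lemma ga_norm_mul x y : ga_norm (ga_mul x y) <= ga_norm x * ga_norm y.
Proof.
rewrite -sum_ga_mul; apply: ler_sum => g _.
by rewrite (le_trans (ler_norm_sum _ _ _))//; under eq_bigr do rewrite normrM.
Qed.

Lemma ga_norm_nneg y : (forall g, 0 <= y g) -> ga_norm y = \sum_g y g.
Proof. by move=> y0; apply: eq_bigr => g _; rewrite ger0_norm. Qed.

Lemma ga_mul_ge0 x y : (forall g, 0 <= x g) -> (forall g, 0 <= y g) ->
  forall g, 0 <= ga_mul x y g.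
Proof. by move=> x0 y0 g; apply: sumr_ge0 => h _; rewrite mulr_ge0. Qed.

Lemma inS_e : inS (@ga_e R gT).
Proof.
split=> [|g]; last exact: ler0n.
rewrite /ga_e (bigD1 1%g)//= eqxx big1 ?addr0// => h /negPf -> //.
Qed.

Lemma inS_mul {x y} : inS x -> inS y -> inS (ga_mul x y).
Proof.
move=> [x1 x0] [y1 y0]; split; last exact: ga_mul_ge0.
by rewrite sum_ga_mul x1 y1 mulr1.
Qed.

Lemma inS_pow {x} k : inS x -> inS (ga_pow x k).
Proof. by move=> Sx; elim: k => [|k IH]; [exact: inS_e | exact: inS_mul]. Qed.

Lemma ga_pow_le1 {x} k g : inS x -> `|ga_pow x k g| <= 1.
Proof.
move=> /(inS_pow k)[<- y0]; rewrite -ga_norm_nneg//; exact: ler_ga_norm.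
Qed.

(** Nonnegative coefficients cannot cancel. This reduces supports of powers of x to powers of the
    subset Supp x. *)
Lemma ga_supp_mul x y : (forall g, 0 <= x g) -> (forall g, 0 <= y g) ->
  ga_supp (ga_mul x y) = (ga_supp x * ga_supp y)%g.
Proof.
move=> x0 y0; apply/setP => g; rewrite inE; apply/idP/mulsgP => [|[h k]].
  apply: contra_neqP => nex; apply: big1 => h _.
  apply/eqP; rewrite mulf_eq0; case: eqVneq => //= xh; case: eqVneq => //= yh.
  by case: nex; exists h (h^-1 * g)%g; rewrite ?inE// mulKVg.
rewrite !inE => xh yk ->; rewrite gt_eqF// /ga_mul (bigD1 h)//= mulKg.
apply: ltr_pwDl; first by rewrite mulr_gt0// lt0r ?xh ?yk ?x0 ?y0.
by apply: sumr_ge0 => i _; rewrite mulr_ge0.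
Qed.

Lemma ga_supp_e : ga_supp (@ga_e R gT) = 1%g.
Proof. by apply/setP => g; rewrite !inE pnatr_eq0 eqb0 negbK. Qed.

Lemma ga_supp_pow {x} k : inS x -> ga_supp (ga_pow x k) = (ga_supp x ^+ k)%g.
Proof.
move=> Sx; elim: k => [|k IH]; first by rewrite ga_supp_e.
by rewrite ga_supp_mul ?IH ?expgSr//; [case: (inS_pow k Sx)|case: Sx].
Qed.

Lemma ga_supp_neq0 {x} : inS x -> exists s, s \in ga_supp x.
Proof.
move=> [x1 _]; apply/set0Pn; apply/negP => /eqP x0.
have := oner_neq0 R; rewrite -x1 big1 ?eqxx// => g _.
by move/setP/(_ g): x0; rewrite !inE => /negbFE/eqP.
Qed.

(** The uniform probability measure on a left coset, indexed by any representative; for H = G_x and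
    t = 1 it is c_x. *)
Definition coset_unif H t : gT -> R := fun g => (g \in t *: H)%g%:R / #|H|%:R.

Lemma card_neq0 H : #|H|%:R != 0 :> R.
Proof. by rewrite pnatr_eq0 -lt0n cardG_gt0. Qed.

(** Left cosets are equal or disjoint. Summing over one coset therefore singles out one term of a
    combination of coset measures. *)
Lemma sum_coset_unif H t t' :
  \sum_(g in (t *: H)%g) coset_unif H t' g = (t' \in t *: H)%g%:R.
Proof.
rewrite /coset_unif; case: (boolP (t' \in t *: H)%g) => [tt'|ntt'].
  under eq_bigr => g gt do rewrite (lcoset_eqP tt') gt.
  by rewrite sumr_const card_lcoset mul1r -[LHS]mulr_natr mulVf// card_neq0.
apply: big1 => g gt; case: (boolP (g \in _)) => [gt'|]; last by rewrite mul0r.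
by case/negP: ntt'; rewrite -(lcoset_eqP gt) (lcoset_eqP gt') lcoset_refl.
Qed.

Lemma sum_over_supp (P : {pred gT}) y :
  ga_supp y \subset P -> \sum_(g in P) y g = \sum_g y g.
Proof.
move=> /fintype.subsetP sP; rewrite big_mkcond; apply: eq_bigr => g _; case: ifPn => // gP.
by apply/esym/eqP/negPn; apply: contra gP => yg; apply: sP; rewrite inE.
Qed.

(** Right multiplication by y spreads H over the right cosets Hh with h in Supp y; as t normalises
    H, each of them is tH. *)
Lemma unif_mull H t y : t \in 'N(H)%g -> \sum_g y g = 1 ->
  ga_supp y \subset (t *: H)%g ->
  ga_mul (coset_unif H 1) y = coset_unif H t.
Proof.
move=> tN y1 /fintype.subsetP sy; apply/funext => g; rewrite /ga_mul /coset_unif.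
rewrite (reindex_inj (mulgI g)) (reindex_inj invg_inj)/=.
under eq_bigr => h _ do rewrite invMg invgK mulgKV.
have E h : y h != 0 -> (g * h^-1 \in 1 *: H)%g = (g \in t *: H)%g.
  move=> yh; rewrite lcoset1. have := sy h; rewrite inE => /(_ yh).
  rewrite -!(norm_rlcoset tN) => /rcoset_eqP <-; by rewrite mem_rcoset.
transitivity (\sum_h (g \in (t *: H)%g)%:R / #|H|%:R * y h).
  apply: eq_bigr => h _; case: (eqVneq (y h) 0) => [->|/E ->]//; by rewrite !mulr0.
by rewrite -mulr_sumr y1 mulr1.
Qed.

Lemma unif_mulr H t y : \sum_g y g = 1 ->
  ga_supp y \subset (t *: H)%g ->
  ga_mul y (coset_unif H 1) = coset_unif H t.
Proof.
move=> y1 /fintype.subsetP sy; apply/funext => g; rewrite /ga_mul /coset_unif.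
transitivity (\sum_h (g \in (t *: H)%g)%:R / #|H|%:R * y h).
  apply: eq_bigr => h _; rewrite mulrC.
  case: (eqVneq (y h) 0) => [->|yh]; first by rewrite !mulr0.
  have := sy h; rewrite inE => /(_ yh) /lcoset_eqP <-.
  by rewrite lcoset1 mem_lcoset.
by rewrite -mulr_sumr y1 mulr1.
Qed.

Lemma inS_unif H t : inS (coset_unif H t).
Proof.
split=> [|g]; last by rewrite divr_ge0 ?ler0n.
rewrite -(sum_over_supp (mem (t *: H)%g)) ?sum_coset_unif ?lcoset_refl//.
apply/fintype.subsetP => g; rewrite inE /coset_unif; apply: contraNT => /negPf.
by move=> /= ->; rewrite mul0r.
Qed.

Lemma ga_supp_unif H t : ga_supp (coset_unif H t) = (t *: H)%g.
Proof.
apply/setP => g; rewrite inE /coset_unif; case: (g \in _).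
  by rewrite mulf_neq0 ?oner_neq0 ?invr_neq0 ?card_neq0.
by rewrite mul0r eqxx.
Qed.

Lemma c_of_unif x : c_of x = coset_unif (G_of x) 1.
Proof. by apply/funext => g; rewrite /coset_unif lcoset1. Qed.

End GroupAlgebraTheory.

(** * Powers of subsets of a finite group *)

Section SetPowers.
Context {gT : finGroupType}.
Implicit Types (X : {set gT}) (H : {group gT}) (s : gT) (n k : nat).
Local Open Scope group_scope.

(** In a finite group the generated subgroup is a power of X with 1 adjoined, and here 1 is already
    in X. *)
Lemma gen_expgs1 X : 1 \in X -> exists K, <<X>> = X ^+ K.
Proof.
move=> X1; have [K] := gen_expgs X; rewrite (finset.setUidPr _) ?finset.sub1set//.
by exists K.
Qed.

Lemma mem_expgs X s k : s \in X -> s ^+ k \in X ^+ k.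
Proof. by move=> sX; elim: k => [|k IH]; rewrite ?set11// !expgSr mem_mulg. Qed.

(* With [H = <<X ^+ n>>] a power of [X], [X] and [H] commute; translating [X H]
   by an element of [X ^+ n.-1] lands in [H], so [X H] is a single coset. *)
Lemma expgs_gen_coset X n s : s \in X -> (0 < n)%N -> 1 \in X ^+ n ->
  X * <<X ^+ n>> = s *: <<X ^+ n>> /\ s \in 'N(<<X ^+ n>>).
Proof.
move=> sX n0 Xn1; set H := (<<X ^+ n>>)%G; rewrite -[<<_>>]/(gval H).
have [K EH] := gen_expgs1 _ Xn1.
have XH : X * H = H * X by rewrite /= EH -expgM -expgS expgSr.
have cXH : (#|(X * H)%g| <= #|H|)%N.
  rewrite -(card_lcoset (X * H) (s ^+ n.-1)) subset_leq_card//.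
  rewrite (@fintype.subset_trans _ _ (X ^+ n.-1 * (X * H))%g)//.
    by rewrite mulSg// finset.sub1set mem_expgs.
  by rewrite mulgA -expgSr prednK// (@mulSgGid _ H _ _ Xn1 (subset_gen _)).
have E1 : s *: H = X * H.
  by apply/eqP; rewrite eqEcard mulSg ?finset.sub1set//= card_lcoset.
have E2 : H :* s = X * H.
  by apply/eqP; rewrite eqEcard {1}XH mulgS ?finset.sub1set//= card_rcoset.
split=> //; apply/normP; rewrite conjsgE E2 -E1.
by rewrite mulgA mulg_set1 mulVg mul1g.
Qed.

Lemma expgs_coset X H s k : X * H = s *: H -> s \in 'N(H) ->
  X ^+ k * H = s ^+ k *: H.
Proof.
move=> XH sN; elim: k => [|k IH]; first by rewrite !expg0.
rewrite expgSr -mulgA XH -(norm_rlcoset sN) mulgA IH -mulgA (norm_rlcoset sN).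
by rewrite mulgA mulg_set1 -expgSr.
Qed.

End SetPowers.

(** * The indices n_x and m_x and the group G_x *)

Section Indices.
Context {R : realType} {gT : finGroupType}.
Implicit Types (x y : gT -> R).

Lemma n_ofP x : inS x -> (0 < n_of x)%N /\ (1 \in ga_supp x ^+ n_of x)%g.
Proof.
move=> Sx; rewrite /n_of; case: pselect => [h|[]].
  by case: ex_minnP => n /andP[n0 xn] _; split; rewrite // -ga_supp_pow ?inE.
(* The default value 0 cannot occur: for s in Supp x, the power of s to its own order is the
   identity. *)
have [s sX] := ga_supp_neq0 Sx; exists #[s]%g; rewrite order_gt0/=.
by have := mem_expgs _ _ #[s]%g sX; rewrite expg_order -(ga_supp_pow _ Sx) inE.
Qed.

Lemma m_ofP x : inS x -> [/\ (0 < m_of x)%N,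
  ga_supp (ga_pow x (m_of x)) \subset G_of x &
  forall k, (0 < k)%N -> ga_supp (ga_pow x k) \subset G_of x -> (m_of x <= k)%N].
Proof.
move=> Sx; rewrite /m_of; case: pselect => [h|[]].
  case: ex_minnP => m /andP[m0 xm] mmin; split=> // k k0 xk.
  by rewrite mmin ?k0.
(* The exponent n_x qualifies, since G_x is generated by the support of that power. *)
by exists (n_of x); rewrite sub_gen// andbT; case: (n_ofP _ Sx).
Qed.

(** Any s in Supp x serves. If s^i and s^j span the same coset with i < j < m_x, then x^(j-i) is
    supported in G_x, against the minimality of m_x. *)
Lemma G_of_cosets x : inS x -> exists s,
  [/\ s \in 'N(G_of x)%g,
      forall k, ga_supp (ga_pow x k) \subset (s ^+ k *: G_of x)%g,
      (s ^+ m_of x \in G_of x)%g &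
      forall i j, (i < m_of x)%N -> (j < m_of x)%N ->
        (s ^+ i \in s ^+ j *: G_of x)%g -> i = j].
Proof.
move=> Sx; have [s sX] := ga_supp_neq0 Sx; exists s.
have [n0 n1] := n_ofP _ Sx; have [m0 xm mmin] := m_ofP _ Sx.
have [XH sN] : (ga_supp x * G_of x)%g = (s *: G_of x)%g /\ s \in 'N(G_of x)%g.
  by rewrite /G_of (ga_supp_pow _ Sx); exact: expgs_gen_coset.
have sub k : ga_supp (ga_pow x k) \subset (s ^+ k *: G_of x)%g.
  by rewrite (ga_supp_pow _ Sx) -(expgs_coset _ _ _ k XH sN) mulG_subl.
split=> //.
  by apply: (fintype.subsetP xm); rewrite (ga_supp_pow _ Sx) mem_expgs.
have key i j : (i <= j)%N -> (j < m_of x)%N -> (s ^+ j \in s ^+ i *: G_of x)%g -> i = j.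
  move=> ij jm; rewrite mem_lcoset -{1}(subnKC ij) expgnDr mulKg => sH.
  apply/eqP; rewrite eqn_leq ij leqNgt /=; apply/negP => lt_ij.
  have := mmin (j - i)%N; rewrite subn_gt0 lt_ij => /(_ isT).
  have := sub (j - i)%N; rewrite (lcoset_eqP (_ : _ \in 1%g *: _)%g) ?lcoset1// => h /(_ h).
  by rewrite leqNgt (leq_ltn_trans _ jm)// leq_subr.
move=> i j im jm; case: (leqP i j) => [ij|/ltnW ji] sH; last exact/esym/key.
by apply: key => //; rewrite (lcoset_eqP sH) lcoset_refl.
Qed.

(** G_x is a power of Supp(x^n) with n = n_x, hence of Supp x. The exponent L found here is the step
    length of the contraction. *)
Lemma supp_pow_G_of x : inS x ->
  exists L, ga_supp (ga_pow x L) = G_of x.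
Proof.
move=> Sx; have [_ n1] := n_ofP _ Sx; have [K E] := gen_expgs1 _ n1.
exists (n_of x * K)%N.
by rewrite (ga_supp_pow _ Sx) expgM -E -(ga_supp_pow _ Sx).
Qed.

End Indices.

(** * Decay of x^k - x^k c_x *)

Section Decay.
Context {R : realType} {gT : finGroupType}.
Implicit Types (x y z : gT -> R) (H : {group gT}).

Lemma ga_mulBl x y z :
  ga_mul (fun g => x g - y g) z = (fun g => ga_mul x z g - ga_mul y z g).
Proof.
apply/funext => g; rewrite /ga_mul -sumrB.
by apply: eq_bigr => h _; rewrite mulrBl.
Qed.

Lemma unif_idem H t :
  ga_mul (coset_unif H t) (coset_unif H 1) = coset_unif H t :> (gT -> R).
Proof. by apply: unif_mulr; [case: (@inS_unif R _ H t)|rewrite ga_supp_unif]. Qed.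

(* Doeblin's argument: [z] dominates a multiple of the uniform measure on [H],
   which annihilates [y] and can be subtracted from [z]. *)
Lemma ga_norm_contraction H z : inS z -> ga_supp z = H ->
  exists2 rho : R, rho < 1 & forall y,
    (forall g, ga_mul y (coset_unif H 1) g = 0) ->
    ga_norm (ga_mul y z) <= rho * ga_norm y.
Proof.
move=> [z1 z0] zH.
have [d d0 zd] : exists2 d : R, 0 < d & forall g, g \in H -> d <= z g.
  have [g gH gmin] := @arg_minP _ _ _ 1%g (mem H) z (group1 H).
  exists (z g) => //; rewrite lt0r z0 andbT.
  have gz : g \in ga_supp z by rewrite zH.
  by rewrite inE in gz.
pose w g := z g - d * (g \in H)%:R.
have w0 g : 0 <= w g.
  rewrite /w; case: (boolP (g \in H)) => [/zd|_];
    by rewrite ?mulr1 ?mulr0 ?subr0// subr_ge0.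
(* The total mass of the nonnegative remainder [w], with d the minimum of z on H. *)
exists (1 - d * #|H|%:R).
  by rewrite ltrBlDr ltrDl mulr_gt0// ltr0n cardG_gt0.
move=> y yc.
have -> : ga_mul y z = ga_mul y w.
  apply/funext => g; rewrite -[RHS](addr0) -[in RHS](mulr0 (d * #|H|%:R)) -(yc g).
  rewrite /ga_mul mulr_sumr -big_split; apply: eq_bigr => h _ /=.
  rewrite /w /coset_unif lcoset1 mulrCA -mulrDr; congr (_ * _).
  by rewrite -[d * _ * _]mulrA [#|H|%:R * _]mulrC divfK ?card_neq0// subrK.
rewrite mulrC; apply: (le_trans (ga_norm_mul _ _)).
rewrite ler_wpM2l ?ga_norm_ge0// ga_norm_nneg// sumrB z1 lerB// -mulr_sumr.
rewrite -sum1_card natr_sum big_mkcond /=.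
rewrite ler_wpM2l ?(ltW d0)// ler_sum// => g _; by case: ifP.
Qed.

(** Splitting off the first L of n + L terms bounds the sum T of n terms by C + rho T, with C the
    sum of those L terms; then solve for T. *)
Lemma sum_le_of_contraction (u : nat -> R) L rho : (forall k, 0 <= u k) ->
  rho < 1 -> (forall k, u (k + L)%N <= rho * u k) ->
  exists B, forall n, \sum_(k < n) u k <= B.
Proof.
move=> u0 rho1 uL; exists ((\sum_(k < L) u k) / (1 - rho)) => n.
rewrite ler_pdivlMr ?subr_gt0// mulrBr mulr1 lerBlDr.
have H1 : \sum_(k < n) u k <= \sum_(k < n + L) u k.
  by rewrite big_split_ord/= lerDl sumr_ge0.
apply: (le_trans H1); rewrite addnC big_split_ord/= lerD2l mulrC mulr_sumr.
by apply: ler_sum => k _; rewrite addnC uL.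
Qed.

(** Put y = x^k - x^k c. As x^L c = c x^L = c, the difference for k + L is y x^L, and y c = 0
    because c is idempotent, so the contraction applies. *)
Lemma sum_ga_pow_sub_c x : inS x -> exists B : R, forall n,
  \sum_(k < n) ga_norm (fun g => ga_pow x k g - ga_mul (ga_pow x k) (c_of x) g) <= B.
Proof.
move=> Sx; have [L xL] := supp_pow_G_of x Sx.
have [rho rho1 hrho] := ga_norm_contraction _ _ (inS_pow L Sx) xL.
apply: (sum_le_of_contraction (fun k => ga_norm (fun g =>
  ga_pow x k g - ga_mul (ga_pow x k) (c_of x) g)) L rho) => // k.
  exact: ga_norm_ge0.
rewrite c_of_unif; set c := coset_unif _ _.
have cL : ga_mul c (ga_pow x L) = c.
  by apply: unif_mull; rewrite ?group1 ?xL ?lcoset1//; case: (inS_pow L Sx).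
have Lc : ga_mul (ga_pow x L) c = c.
  by apply: unif_mulr; rewrite ?xL ?lcoset1//; case: (inS_pow L Sx).
set y := fun g => ga_pow x k g - _.
have -> : (fun g => ga_pow x (k + L) g - ga_mul (ga_pow x (k + L)) c g)
   = ga_mul y (ga_pow x L).
  by rewrite ga_mulBl ga_powD -!ga_mulA cL Lc.
by apply: hrho => g; rewrite ga_mulBl -ga_mulA unif_idem subrr.
Qed.

End Decay.

(** * Absolutely convergent series and residue classes *)

Section Series.
Local Open Scope classical_set_scope.
Context {R : realType}.
Implicit Types (u f : nat -> R).

Lemma sum_nat_residues u N m :
  \sum_(0 <= k < N * m) u k = \sum_(r < m) \sum_(0 <= j < N) u (j * m + r)%N.
Proof.
elim: N => [|N IH]; first by rewrite mul0n big_geq// big1// => r _; rewrite big_geq.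
under [RHS]eq_bigr do rewrite big_nat_recr//=.
rewrite big_split/= -IH mulSn addnC (@big_cat_nat _ _ _ (N * m)%N)//= ?leq_addr//.
congr (_ + _); rewrite -{1}[(N * m)%N]add0n big_addn addKn big_mkord.
by apply: eq_bigr => i _; rewrite addnC.
Qed.

Lemma cvgn_series_bounded u f (M : R) : cvgn (series (fun k => `|u k|)) ->
  (forall k, `|f k| <= M) -> cvgn (series (fun k => u k * f k)).
Proof.
move=> cu fM; apply: normed_cvg; rewrite /normed_series_of/=.
apply: (@series_le_cvg _ _ (fun k => M * `|u k|)) => //.
- by move=> k; rewrite mulr_ge0// (le_trans _ (fM k)).
- by move=> k; rewrite normrM mulrC ler_wpM2r.
- have -> : series (fun k => M * `|u k|) = (fun n => M * series (fun k => `|u k|) n).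
    by apply/funext => n; rewrite /series/= -mulr_sumr.
  by apply: is_cvgM => //; exact: is_cvg_cst.
Qed.

(** Needed because [peval] keeps the constant term outside its series. *)
Lemma limn_series_recl u : cvgn (series u) ->
  cvgn (series (fun k => u k.+1)) /\
  limn (series u) = u 0%N + limn (series (fun k => u k.+1)).
Proof.
move=> cu.
have E : (fun n => series (fun k => u k.+1) n) = (fun n => series u n.+1 - u 0%N).
  by apply/funext => n; rewrite /series/= big_nat_recl// addrC addKr.
have cS : series (fun k => u k.+1) @ \oo --> limn (series u) - u 0%N.
  rewrite [X in X @ \oo --> _]E; apply: cvgB; last exact: cvg_cst.
  by rewrite (cvg_shiftS (series u)).
split; first by apply/cvg_ex; eexists; exact: cS.
by rewrite (cvg_lim _ cS)// addrC subrK.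
Qed.

Lemma cvgn_series_residue u m r : (r < m)%N -> cvgn (series (fun k => `|u k|)) ->
  cvgn (series (fun j => u (j * m + r)%N)).
Proof.
move=> rm cu; apply: normed_cvg; rewrite /normed_series_of/=.
apply: nondecreasing_is_cvgn.
  by apply/nondecreasing_seqP => n; rewrite /series/= big_nat_recr//= lerDl.
exists (limn (series (fun k => `|u k|))) => _ [N _ <-].
have nd : nondecreasing_seq (series (fun k => `|u k|)).
  by apply/nondecreasing_seqP => n; rewrite /series/= big_nat_recr//= lerDl.
(* The first N terms of one residue class are among the first N m terms of the whole series. *)
apply: le_trans (nondecreasing_cvgn_le nd cu (N * m)%N).
rewrite /series/= (sum_nat_residues (fun k => `|u k|)) (bigD1 (Ordinal rm))//= lerDl.
by apply: sumr_ge0 => i _; exact: sumr_ge0.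
Qed.

(** The limit may be computed along partial sums of length N m, which split exactly into residue
    classes on which f is constant. *)
Lemma limn_series_periodic u f (M : R) m : (0 < m)%N ->
  cvgn (series (fun k => `|u k|)) -> (forall k, `|f k| <= M) ->
  (forall j r, f (j * m + r)%N = f r) ->
  limn (series (fun k => u k * f k)) =
  \sum_(r < m) f r * limn (series (fun j => u (j * m + r)%N)).
Proof.
move=> m0 cu fM fm; have cv := cvgn_series_bounded u f M cu fM.
have := cvg_comp _ _ (cvg_mulnr m m0) cv; move/cvg_lim => <- //.
apply: cvg_lim => //.
have -> : series (fun k => u k * f k) \o (fun N => N * m)%N =
  (fun N => \sum_(r < m) f r * series (fun j => u (j * m + r)%N) N).
  apply/funext => N; rewrite /= /series/= sum_nat_residues; apply: eq_bigr => r _.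
  by rewrite mulr_sumr; apply: eq_bigr => j _; rewrite fm mulrC.
apply: cvg_big => [|r _]; first exact: add_continuous.
by apply: cvgM; [exact: cvg_cst | exact: cvgn_series_residue].
Qed.

Lemma ler_norm_limn u (M : R) : cvgn u -> (forall n, `|u n| <= M) -> `|limn u| <= M.
Proof.
move=> cu uM; rewrite ler_norml; apply/andP; split.
  by apply: limr_ge => //; apply: nearW => n; have := uM n; rewrite ler_norml => /andP[].
by apply: limr_le => //; apply: nearW => n; have := uM n; rewrite ler_norml => /andP[].
Qed.

(** For [sup] to be an upper bound the range must be bounded; the sum of the series bounds every
    term. *)
Lemma ler_sup_range u k : cvgn (series (fun k => `|u k|)) ->
  `|u k| <= sup (range (fun k => `|u k|)).
Proof.
move=> cu; apply: ub_le_sup; last by exists k.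
exists (limn (series (fun k => `|u k|))) => _ [n _ <-].
have nd : nondecreasing_seq (series (fun k => `|u k|)).
  by apply/nondecreasing_seqP => i; rewrite /series/= big_nat_recr//= lerDl.
apply: le_trans (nondecreasing_cvgn_le nd cu n.+1).
by rewrite /series/= big_nat_recr//= lerDr sumr_ge0.
Qed.

End Series.

Local Open Scope classical_set_scope.

(** * Splitting p(x) into a periodic part and an error *)

Section PowerSeries.
Context {R : realType} {gT : finGroupType}.
Implicit Types (b : nat -> R) (x : gT -> R).

Lemma coset_unif_eq (H : {group gT}) t t' : (t \in t' *: H)%g ->
  coset_unif H t = coset_unif H t' :> (gT -> R).
Proof. by move=> tt'; rewrite /coset_unif (lcoset_eqP tt'). Qed.

(** The products with c on the right serve to decompose p(x); those with c on the left give the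
    limit formula, where c stands in front. *)
Lemma ga_pow_mul_c x : inS x -> exists s : gT,
  [/\ forall k, ga_mul (ga_pow x k) (c_of x) = coset_unif (G_of x) (s ^+ k)%g,
      forall k, ga_mul (c_of x) (ga_pow x k) = coset_unif (G_of x) (s ^+ k)%g,
      forall j r, coset_unif (G_of x) (s ^+ (j * m_of x + r))%g
        = coset_unif (G_of x) (s ^+ r)%g :> (gT -> R) &
      forall i j, (i < m_of x)%N -> (j < m_of x)%N ->
        (s ^+ i \in s ^+ j *: G_of x)%g -> i = j].
Proof.
move=> Sx; have [s [sN sub sm inj]] := G_of_cosets x Sx; exists s; split=> //.
- by move=> k; rewrite c_of_unif; apply: unif_mulr; [case: (inS_pow k Sx)|].
- by move=> k; rewrite c_of_unif; apply: unif_mull; [rewrite groupX|case: (inS_pow k Sx)|].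
- move=> j r; apply: coset_unif_eq.
  by rewrite mem_lcoset addnC expgnDr mulKg mulnC expgM groupX.
Qed.

(* The part of [p(x) (e - c)] coming from the monomials of positive degree. *)
Definition peval_err b x g : R := limn (series (fun k =>
  b k.+1 * (ga_pow x k.+1 g - ga_mul (ga_pow x k.+1) (c_of x) g))).

Lemma ga_pow_mul_c_le1 x k g : inS x -> `|ga_mul (ga_pow x k) (c_of x) g| <= 1.
Proof.
move=> Sx; have S : inS (ga_mul (ga_pow x k) (c_of x)).
  by rewrite c_of_unif; apply: inS_mul; [exact: inS_pow|exact: inS_unif].
(* The bound on powers is used with exponent 1. *)
by have := ga_pow_le1 1 g S; rewrite /= ga_mul1l.
Qed.

Lemma cvgn_err_series b x g : cvgn (series (fun k => `|b k|)) -> inS x ->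
  cvgn (series (fun k =>
    b k.+1 * (ga_pow x k.+1 g - ga_mul (ga_pow x k.+1) (c_of x) g))).
Proof.
move=> cb Sx; have [cb1 _] := limn_series_recl _ cb.
apply: (cvgn_series_bounded (fun k => b k.+1) _ (1 + 1) cb1) => k.
by rewrite (le_trans (ler_normB _ _))// lerD ?ga_pow_le1 ?ga_pow_mul_c_le1.
Qed.

(** Write x^k = x^k c + (x^k - x^k c) for k >= 1. The residue sums also contain b_0 c, so the
    constant term leaves b_0 (e - c). *)
Lemma peval_decomp b x g : cvgn (series (fun k => `|b k|)) -> inS x ->
  peval b x g = b 0%N * (@ga_e R gT g - c_of x g)
    + \sum_(r < m_of x) ga_mul (ga_pow x r) (c_of x) g
        * limn (series (fun j => b (j * m_of x + r)%N))
    + peval_err b x g.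
Proof.
move=> cb Sx; have [m0 _ _] := m_ofP x Sx.
have [s [Us _ per _]] := ga_pow_mul_c x Sx.
have [cb1 _] := limn_series_recl _ cb.
have fc k : `|ga_mul (ga_pow x k) (c_of x) g| <= 1 by exact: ga_pow_mul_c_le1.
have cf := cvgn_series_bounded _ _ _ cb fc.
have [cf1 Ef] := limn_series_recl _ cf.
rewrite -(limn_series_periodic b (fun k => ga_mul (ga_pow x k) (c_of x) g) 1)//; last first.
  by move=> j r; rewrite !Us per.
rewrite Ef /= ga_mul1l /peval /peval_err.
set u := limn _.
suff -> : u = limn (series (fun k => b k.+1 * ga_mul (ga_pow x k.+1) (c_of x) g))
   + limn (series (fun k =>
      b k.+1 * (ga_pow x k.+1 g - ga_mul (ga_pow x k.+1) (c_of x) g))) by lra.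
rewrite -limD//; last exact: cvgn_err_series.
congr (limn _); apply/funext => n; rewrite fctE /series/= -big_split/=.
by apply: eq_bigr => k _; rewrite -mulrDr addrC subrK.
Qed.

(** B depends on x alone, so the estimate is uniform in the power series. *)
Lemma peval_err_le x : inS x -> exists B : R, forall b g,
  cvgn (series (fun k => `|b k|)) ->
  `|peval_err b x g| <= sup (range (fun k => `|b k.+1|)) * B.
Proof.
move=> Sx; have [B hB] := sum_ga_pow_sub_c x Sx; exists B => b g cb.
have [cb1 _] := limn_series_recl _ cb.
apply: ler_norm_limn => [|n]; first exact: cvgn_err_series.
have sup0 : 0 <= sup (range (fun k => `|b k.+1|)).
  by apply: le_trans (ler_sup_range (fun k => b k.+1) 0%N cb1).
apply: le_trans (ler_wpM2l sup0 (hB n.+1)).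
(* The bound sums from k = 0 while the error starts at k = 1; the extra term is nonnegative. *)
rewrite big_ord_recl mulrDr ler_wpDl ?mulr_ge0 ?ga_norm_ge0//.
rewrite /series/= big_mkord (le_trans (ler_norm_sum _ _ _))// mulr_sumr.
apply: ler_sum => k _; rewrite normrM ler_pM//.
  exact: (ler_sup_range (fun k => b k.+1)).
exact: (ler_ga_norm (fun g => ga_pow x k.+1 g - ga_mul (ga_pow x k.+1) (c_of x) g)).
Qed.

End PowerSeries.

(** * Convergence criterion and limit formula *)

Theorem theorem2 (R : realType) (gT : finGroupType)
    (a : nat -> nat -> R) (x : gT -> R) :
  (forall n, cvgn (series (fun k => `|a n k|))) ->
  (fun n => sup (range (fun k => `|a n k.+1|))) @ \oo --> (0 : R) ->
  inS x ->
  n_of (ga_mul x (c_of x)) = n_of x ->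
  let m := m_of x in
  let c := c_of x in
  let A := fun r n => limn (series (fun k => a n (k * m + r)%N)) in
  let conv := forall g, cvgn (fun n => peval (a n) x g) in
  (c <> @ga_e R gT ->
     (conv <-> (cvgn (fun n => a n 0%N) /\ forall r, (r < m)%N -> cvgn (A r)))) /\
  (c = @ga_e R gT ->
     (conv <-> (forall r, (r < m)%N -> cvgn (A r)))) /\
  (conv ->
     forall g, (fun n => peval (a n) x g) @ \oo -->
       ga_mul c (fun h => \sum_(r < m) ga_pow x r h * limn (A r)) g
       + (@ga_e R gT g - c g) * limn (fun n => a n 0%N)).
Proof.
move=> ca sup0 Sx _ m c A conv.
have [s [Us Us' _ inj]] := ga_pow_mul_c x Sx.
pose U r := coset_unif (G_of x) (s ^+ r)%g : gT -> R.
pose D g : R := @ga_e R gT g - c g.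
(* The main part of p(x): it differs from p(x) by an error tending to 0. *)
pose q n g := a n 0%N * D g + \sum_(r < m) U r g * A r n.
have err0 g : (fun n => peval_err (a n) x g) @ \oo --> (0 : R).
  have [B hB] := peval_err_le x Sx.
  apply: norm_cvg0; apply: (@squeeze_cvgr _ _ _ _ (cst 0)
    (fun n => sup (range (fun k => `|a n k.+1|)) * B)).
  - by apply: nearW => n; rewrite normr_ge0 hB.
  - exact: cvg_cst.
  - by rewrite -[X in _ --> X](mul0r B); apply: cvgM => //; exact: cvg_cst.
have pq n g : peval (a n) x g = q n g + peval_err (a n) x g.
  rewrite peval_decomp//; congr (_ + _ + _).
  by apply: eq_bigr => r _; rewrite Us.
(* Both e and c have mass 1 on the coset G_x and 0 on every other coset. *)
have D1 r : \sum_(g in (s ^+ r *: G_of x)%g) D g = 0.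
  rewrite sumrB /c c_of_unif sum_coset_unif; apply/eqP; rewrite subr_eq0; apply/eqP.
  rewrite big_mkcond (bigD1 1%g)//= big1 ?addr0 /ga_e ?eqxx; first by case: ifP.
  by move=> g /negPf ->; case: ifP.
(* The a_0 term sums to 0 by [D1], and the cosets for the other residues are disjoint from this
   one. *)
have Aq r n : (r < m)%N -> A r n = \sum_(g in (s ^+ r *: G_of x)%g) q n g.
  move=> rm; rewrite big_split/= -mulr_sumr D1 mulr0 add0r exchange_big/=.
  rewrite (bigD1 (Ordinal rm))//= -mulr_suml sum_coset_unif lcoset_refl mul1r.
  rewrite big1 ?addr0// => i ir; rewrite -mulr_suml sum_coset_unif.
  case: (boolP (_ \in _)) => [/(inj _ _ (ltn_ord i) rm) E|_]; last by rewrite mul0r.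
  by case/eqP: ir; apply/val_inj.
have convq : conv -> forall g, cvgn (fun n => q n g).
  move=> cv g.
  have -> : (fun n => q n g) = (fun n => peval (a n) x g - peval_err (a n) x g).
    by apply/funext => n; rewrite pq addrK.
  by apply: is_cvgB => //; apply/cvg_ex; exists 0; exact: err0.
have convA : conv -> forall r, (r < m)%N -> cvgn (A r).
  move=> cv r rm.
  have -> : A r = (fun n => \sum_(g in (s ^+ r *: G_of x)%g) q n g).
    by apply/funext => n; exact: Aq.
  apply/cvg_ex; eexists; apply: cvg_big => [|g _]; first exact: add_continuous.
  exact: convq.
have cvgA g : (forall r, (r < m)%N -> cvgn (A r)) ->
    (fun n => \sum_(r < m) U r g * A r n) @ \oo --> \sum_(r < m) U r g * limn (A r).
  move=> cA; apply: cvg_big => [|r _]; first exact: add_continuous.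
  by apply: cvgM; [exact: cvg_cst | exact: cA].
(* Once the residue sums converge, a_0 is solved for at a coordinate where e and c differ. *)
have conva g : conv -> D g != 0 -> cvgn (fun n => a n 0%N).
  move=> cv Dg.
  have -> : (fun n => a n 0%N) =
      (fun n => (q n g - \sum_(r < m) U r g * A r n) * (D g)^-1).
    by apply/funext => n; rewrite addrK mulfK.
  apply: is_cvgM; last exact: is_cvg_cst.
  apply: is_cvgB; first exact: convq.
  by apply/cvg_ex; eexists; apply: cvgA; exact: convA.
(* Convergence of a_0 is asked only where e and c differ, which covers both cases: elsewhere its
   factor is 0, whatever value [limn] takes. *)
have limp g : (forall r, (r < m)%N -> cvgn (A r)) ->
    (D g != 0 -> cvgn (fun n => a n 0%N)) ->
    (fun n => peval (a n) x g) @ \oo -->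
       ga_mul c (fun h => \sum_(r < m) ga_pow x r h * limn (A r)) g
       + (@ga_e R gT g - c g) * limn (fun n => a n 0%N).
  move=> cA c0.
  have -> : ga_mul c (fun h => \sum_(r < m) ga_pow x r h * limn (A r)) g =
      \sum_(r < m) U r g * limn (A r).
    rewrite /ga_mul; under eq_bigr do rewrite mulr_sumr.
    rewrite exchange_big; apply: eq_bigr => r _; rewrite /U -Us' mulr_suml.
    by apply: eq_bigr => h _; rewrite mulrA.
  have -> : (fun n => peval (a n) x g) =
     (fun n => \sum_(r < m) U r g * A r n + D g * a n 0%N + peval_err (a n) x g).
    by apply/funext => n; rewrite pq /q addrC [_ * D g]mulrC [D g * _ + _]addrC addrC.
  rewrite -[X in _ --> X]addr0; apply: cvgD => //; apply: cvgD; first exact: cvgA.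
  rewrite -/(D g); case: (eqVneq (D g) 0) => [->|Dg].
    by under eq_cvg do rewrite mul0r; rewrite mul0r; exact: cvg_cst.
  by apply: cvgM; [exact: cvg_cst | exact: c0].
split; [|split].
- move=> ce; split=> [cv|[c0 cA] g].
    split; last exact: convA.
    have [g Dg] : exists g, D g != 0.
      apply: contra_notP ce => nD; apply/funext => g; apply/eqP.
      by rewrite eq_sym -subr_eq0; apply/negPn/negP => Dg; apply: nD; exists g.
    exact: conva Dg.
  by apply/cvg_ex; eexists; apply: limp.
- move=> ce; split=> [|cA g]; first exact: convA.
  by apply/cvg_ex; eexists; apply: limp; rewrite // /D ce subrr eqxx.
- by move=> cv g; apply: limp; [exact: convA | exact: conva].
Qed.
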